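(* Given $\mathrm{Ste}>0$ and $\alpha\ge 0$, there exists a unique solution to problem $(\mathrm{P}_{2h})$, which is given by $$T_{2h}(x,t)=t^{\alpha/2}\left[A_{2h}\theta_\infty\left(1-\frac{x}{s_{2h}(t)}\right)+B_{2h}\theta_\infty\left(1-\frac{x}{s_{2h}(t)}\right)^2\right],\qquad s_{2h}(t)=2a\nu_{2h}\sqrt{t},$$ where the constants $A_{2h}$ and $B_{2h}$ are given by $$A_{2h}=\frac{6\,\mathrm{Ste}-2\,\mathrm{Ste}\,\nu_{2h}^2(\alpha+1)-\frac{3}{\mathrm{Bi}}2^{\alpha+1}\nu_{2h}^{\alpha+1}-3\cdot 2^{\alpha+1}\nu_{2h}^{\alpha+2}}{\mathrm{Ste}\left[\nu_{2h}^2(\alpha+1)+\frac{2}{\mathrm{Bi}}\nu_{2h}(\alpha+1)+3\right]},$$ $$B_{2h}=\frac{-3\,\mathrm{Ste}+3\,\mathrm{Ste}\,\nu_{2h}^2(\alpha+1)+\frac{3}{\mathrm{Bi}}2^{\alpha}\nu_{2h}^{\alpha+1}+3\cdot 2^{\alpha+1}\nu_{2h}^{\alpha+2}}{\mathrm{Ste}\left[\nu_{2h}^2(\alpha+1)+\frac{2}{\mathrm{Bi}}\nu_{2h}(\alpha+1)+3\right]},$$ and where the coefficient $\nu_{2h}$ is the unique solution to the equation $$2^{\alpha}(\alpha+1)z^{\alpha+4}+\frac{2^{\alpha+1}}{\mathrm{Bi}}(\alpha+1)z^{\alpha+3}+3\cdot 2^{\alpha+1}z^{\alpha+2}+3\,\frac{2^{\alpha}}{\mathrm{Bi}}z^{\alpha+1}+\mathrm{Ste}(\alpha+1)z^2-3\,\mathrm{Ste}=0,\qquad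 z>0.$$
   Context: Fix real parameters $k,\rho,c,\gamma,\theta_\infty,h>0$ and $\alpha\ge 0$; put $a=\sqrt{k/(\rho c)}$, and define the generalized Stefan number $\mathrm{Ste}=\dfrac{k\theta_\infty}{\gamma a^{\alpha+2}}$ and the Biot number $\mathrm{Bi}=\dfrac{ah}{k}$. A candidate pair $(T,s)$ consists of a continuous function $s:[0,\infty)\to[0,\infty)$, positive and continuously differentiable on $(0,\infty)$, and a function with quadratic profile in space $$T(x,t)=t^{\alpha/2}\theta_\infty\left[A\left(1-\frac{x}{s(t)}\right)+B\left(1-\frac{x}{s(t)}\right)^2\right],\quad 0\le x\le s(t),\ t>0,$$ with real constants $A,B$. Problem $(\mathrm{P}_{2h})$ (modified heat balance integral method, Robin condition): find a candidate pair $(T,s)=(T_{2h},s_{2h})$ such that, for all $t>0$: (i) $\dfrac{d}{dt}\displaystyle\int_0^{s(t)}T(x,t)\,dx=-a^2\left[\dfrac{\gamma}{k}s(t)^{\alpha}\dot s(t)+\dfrac{\partial T}{\partial x}(0,t)\right]$; (ii) $k\dfrac{\partial T}{\partial x}(0,t)=\dfrac{h}{\sqrt t}\left[T(0,t)-\theta_\infty t^{\alpha/2}\right]$; (iii) $T(s(t),t)=0$; (iv) $k\dfrac{\partial T}{\partial x}(s(t),t)=-\gamma s(t)^{\alpha}\dot s(t)$; and (v) $s(0)=0$. Uniqueness is meant among candidate pairs. *)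

(* Defs.v *)
From Stdlib Require Import Reals.
From Coquelicot Require Import Coquelicot.
Open Scope R_scope.

Definition diffusion_coef (k rho c : R) : R := sqrt (k / (rho * c)).

Definition Stefan_number (k gamma theta alpha a : R) : R :=
  k * theta / (gamma * Rpower a (alpha + 2)).

Definition Biot_number (k h a : R) : R := a * h / k.

Definition quadratic_profile (theta alpha A B : R) (s : R -> R) (x t : R) : R :=
  Rpower t (alpha / 2) *
  (A * theta * (1 - x / s t) + B * theta * (1 - x / s t) ^ 2).

(* [s] and [T] are total functions; only their values on [0 <= t], respectively
   on [0 < t /\ 0 <= x <= s t], are meaningful and constrained. *)
Record candidate (theta alpha : R) (T : R -> R -> R) (s : R -> R) : Prop := {
  candidate_continuous : continuous_on (fun t => 0 <= t) s;
  candidate_nonneg : forall t, 0 <= t -> 0 <= s t;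
  candidate_pos : forall t, 0 < t -> 0 < s t;
  candidate_C1 : forall t, 0 < t -> ex_derive s t /\ continuous (Derive s) t;
  candidate_profile : exists A B : R, forall x t,
    0 < t -> 0 <= x <= s t -> T x t = quadratic_profile theta alpha A B s x t
}.

(* The partial derivative of [T] in space at [(x, t)] is [l], taken within the
   spatial domain [0, s t]; it is therefore one-sided at [x = 0] and [x = s t]. *)
Definition is_derive_space (T : R -> R -> R) (s : R -> R) (x t l : R) : Prop :=
  D_in (fun y => T y t) (fun _ => l) (fun y => 0 <= y <= s t) x.

Definition problem_P2h (k gamma theta h alpha a : R)
    (T : R -> R -> R) (s : R -> R) : Prop :=
  candidate theta alpha T s /\
  (forall t, 0 < t ->
    exists Tx_0 Tx_s : R,
      is_derive_space T s 0 t Tx_0 /\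
      is_derive_space T s (s t) t Tx_s /\
      is_derive (fun r => RInt (fun x => T x r) 0 (s r)) t
        (- a ^ 2 * (gamma / k * Rpower (s t) alpha * Derive s t + Tx_0)) /\
      k * Tx_0 = h / sqrt t * (T 0 t - theta * Rpower t (alpha / 2)) /\
      T (s t) t = 0 /\
      k * Tx_s = - gamma * Rpower (s t) alpha * Derive s t) /\
  s 0 = 0.

Definition A_2h (alpha Ste Bi nu : R) : R :=
  (6 * Ste - 2 * Ste * nu ^ 2 * (alpha + 1)
   - 3 / Bi * Rpower 2 (alpha + 1) * Rpower nu (alpha + 1)
   - 3 * Rpower 2 (alpha + 1) * Rpower nu (alpha + 2))
  / (Ste * (nu ^ 2 * (alpha + 1) + 2 / Bi * nu * (alpha + 1) + 3)).

Definition B_2h (alpha Ste Bi nu : R) : R :=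
  (- 3 * Ste + 3 * Ste * nu ^ 2 * (alpha + 1)
   + 3 / Bi * Rpower 2 alpha * Rpower nu (alpha + 1)
   + 3 * Rpower 2 (alpha + 1) * Rpower nu (alpha + 2))
  / (Ste * (nu ^ 2 * (alpha + 1) + 2 / Bi * nu * (alpha + 1) + 3)).

Definition s_2h (a nu t : R) : R := 2 * a * nu * sqrt t.

Definition T_2h (theta alpha Ste Bi a nu : R) : R -> R -> R :=
  quadratic_profile theta alpha
    (A_2h alpha Ste Bi nu) (B_2h alpha Ste Bi nu) (s_2h a nu).

Definition equation_2h (alpha Ste Bi z : R) : Prop :=
  Rpower 2 alpha * (alpha + 1) * Rpower z (alpha + 4)
  + Rpower 2 (alpha + 1) / Bi * (alpha + 1) * Rpower z (alpha + 3)
  + 3 * Rpower 2 (alpha + 1) * Rpower z (alpha + 2)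
  + 3 * (Rpower 2 alpha / Bi) * Rpower z (alpha + 1)
  + Ste * (alpha + 1) * z ^ 2
  - 3 * Ste = 0.

(* Main.v *)
Require Import Defs.
From Stdlib Require Import Reals Ranalysis5 Lra.
From Coquelicot Require Import Coquelicot.
Open Scope R_scope.

(** Within the quadratic profiles, the conditions (i), (ii) and (iv) at a fixed
    time are algebraic in [s t], [s' t], [A] and [B].  The Robin condition (ii)
    reads [k (A + 2 B) sqrt t = h (1 - A - B) s t].  If [A + B = 1] it forces
    [B = -1] and [A = 2], so the flux at [x = 0] vanishes, (iv) gives [s' > 0],
    and the two sides of (i) have opposite signs.  Hence [A + B <> 1] and (ii)
    alone forces [s] to be a multiple of [sqrt t], so no differential equation
    has to be solved.  For [s = 2 a nu sqrt t] the time drops out, and what is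
    left is a system of three equations in [A], [B], [nu] whose solutions are
    [A_2h], [B_2h] and a root of [equation_2h].  The left-hand side of that
    equation is increasing, negative near [0] and positive at [2]. *)

(** * Auxiliary facts on powers and on rescaling equations *)

Lemma Rpower_plus_pow (x y r : R) (n : nat) :
  0 < x -> INR n = r -> Rpower x (y + r) = Rpower x y * x ^ n.
Proof.
  intros Hx <-; rewrite Rpower_plus, Rpower_pow; trivial.
Qed.

(** This is the tool for removing time and physical units: an equivalence of two equations reduces
    to one [field] identity with a nonzero factor [c]. *)
Lemma eq_iff_of_scaled_diff (c x y x' y' : R) :
  c <> 0 -> x - y = c * (x' - y') -> (x = y <-> x' = y').
Proof.
  intros Hc E; split; intros H.
  - apply Rminus_diag_uniq, (Rmult_eq_reg_l c); trivial; lra.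
  - apply Rminus_diag_uniq; rewrite E, H; ring.
Qed.

Lemma eq_div_of_diff (x n d : R) : d <> 0 -> x * d - n = 0 -> x = n / d.
Proof.
  intros Hd H; apply (Rmult_eq_reg_r d); trivial.
  replace (n / d * d) with n by now field.
  now apply Rminus_diag_uniq.
Qed.

(** ** The equation for [nu] *)

(** Having the left-hand side as a function lets monotonicity and the intermediate value theorem
    apply; [equation_2h] is convertible to its vanishing. *)
Definition lhs_2h (alpha Ste Bi z : R) : R :=
  Rpower 2 alpha * (alpha + 1) * Rpower z (alpha + 4)
  + Rpower 2 (alpha + 1) / Bi * (alpha + 1) * Rpower z (alpha + 3)
  + 3 * Rpower 2 (alpha + 1) * Rpower z (alpha + 2)
  + 3 * (Rpower 2 alpha / Bi) * Rpower z (alpha + 1)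
  + Ste * (alpha + 1) * z ^ 2
  - 3 * Ste.

Lemma lhs_2h_increasing (alpha Ste Bi x y : R) :
  0 <= alpha -> 0 < Ste -> 0 < Bi -> 0 < x -> x < y ->
  lhs_2h alpha Ste Bi x < lhs_2h alpha Ste Bi y.
Proof.
  intros Ha HS HB Hx Hxy; unfold lhs_2h.
  assert (mono : forall c p, 0 < c -> 0 < p ->
            c * Rpower x (alpha + p) < c * Rpower y (alpha + p)).
  { intros c p Hc Hp; apply Rmult_lt_compat_l; trivial.
    apply Rlt_Rpower_l; lra. }
  assert (P0 : 0 < Rpower 2 alpha) by apply exp_pos.
  assert (P1 : 0 < Rpower 2 (alpha + 1)) by apply exp_pos.
  assert (H4 := mono (Rpower 2 alpha * (alpha + 1)) 4
                  ltac:(apply Rmult_lt_0_compat; lra) ltac:(lra)).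
  assert (H3 := mono (Rpower 2 (alpha + 1) / Bi * (alpha + 1)) 3
                  ltac:(apply Rmult_lt_0_compat;
                        [apply Rdiv_lt_0_compat|]; lra) ltac:(lra)).
  assert (H2 := mono (3 * Rpower 2 (alpha + 1)) 2 ltac:(lra) ltac:(lra)).
  assert (H1 := mono (3 * (Rpower 2 alpha / Bi)) 1
                  ltac:(apply Rmult_lt_0_compat;
                        [|apply Rdiv_lt_0_compat]; lra) ltac:(lra)).
  assert (Hsq : Ste * (alpha + 1) * x ^ 2 < Ste * (alpha + 1) * y ^ 2).
  { apply Rmult_lt_compat_l; [apply Rmult_lt_0_compat; lra | nra]. }
  lra.
Qed.

(** All exponents are at least 1, so for [z < 1] the nonconstant terms add up to at most [C * z],
    with [C] the sum of the coefficients. An explicit point inside the domain is needed because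
    [Rpower 0 p] is 1 by convention. *)
Lemma lhs_2h_neg_near_0 (alpha Ste Bi : R) :
  0 <= alpha -> 0 < Ste -> 0 < Bi ->
  exists z, 0 < z < 1 /\ lhs_2h alpha Ste Bi z < 0.
Proof.
  intros Ha HS HB.
  assert (P0 : 0 < Rpower 2 alpha) by apply exp_pos.
  assert (P1 : 0 < Rpower 2 (alpha + 1)) by apply exp_pos.
  set (c4 := Rpower 2 alpha * (alpha + 1)).
  set (c3 := Rpower 2 (alpha + 1) / Bi * (alpha + 1)).
  set (c2 := 3 * Rpower 2 (alpha + 1)).
  set (c1 := 3 * (Rpower 2 alpha / Bi)).
  set (d := Ste * (alpha + 1)).
  assert (Hc4 : 0 < c4) by (apply Rmult_lt_0_compat; lra).
  assert (Hc3 : 0 < c3)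
    by (apply Rmult_lt_0_compat; [apply Rdiv_lt_0_compat|]; lra).
  assert (Hc2 : 0 < c2) by (unfold c2; lra).
  assert (Hc1 : 0 < c1)
    by (apply Rmult_lt_0_compat; [|apply Rdiv_lt_0_compat]; lra).
  assert (Hd : 0 < d) by (apply Rmult_lt_0_compat; lra).
  set (C := c4 + c3 + c2 + c1 + d).
  assert (HC : 0 < C) by (unfold C; lra).
  (* This choice gives [C * z = 3 * Ste * (1 - z)], which is below [3 * Ste], and also [z < 1]. *)
  set (z := 3 * Ste / (C + 3 * Ste)).
  assert (Hz : 0 < z) by (apply Rdiv_lt_0_compat; lra).
  assert (Ez : z * (C + 3 * Ste) = 3 * Ste) by (unfold z; field; lra).
  assert (Hz1 : z < 1) by (apply (Rmult_lt_reg_r (C + 3 * Ste)); lra).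
  assert (Hle : forall c p, 0 < c -> 1 <= p ->
            c * Rpower z (alpha + p) <= c * z).
  { intros c p Hc Hp; apply Rmult_le_compat_l; [lra|].
    rewrite <- (exp_ln z) at 2 by trivial; unfold Rpower.
    assert (ln z < 0) by (rewrite <- ln_1; apply ln_increasing; lra).
    assert (H0 : (alpha + p) * ln z <= ln z) by nra.
    destruct H0 as [H0 | ->]; [left; apply exp_increasing, H0 | right; trivial]. }
  exists z; split; [lra|].
  unfold lhs_2h; fold c4 c3 c2 c1 d.
  assert (H4 := Hle c4 4 Hc4 ltac:(lra)).
  assert (H3 := Hle c3 3 Hc3 ltac:(lra)).
  assert (H2 := Hle c2 2 Hc2 ltac:(lra)).
  assert (H1 := Hle c1 1 Hc1 ltac:(lra)).
  assert (H0 : d * z ^ 2 <= d * z) by (apply Rmult_le_compat_l; nra).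
  assert (0 < z * (3 * Ste)) by (apply Rmult_lt_0_compat; lra).
  unfold C in Ez; lra.
Qed.

Lemma lhs_2h_pos_at_2 (alpha Ste Bi : R) :
  0 <= alpha -> 0 < Ste -> 0 < Bi -> 0 < lhs_2h alpha Ste Bi 2.
Proof.
  intros Ha HS HB; unfold lhs_2h.
  assert (P : forall p, 0 < Rpower 2 p) by (intros; apply exp_pos).
  assert (0 < Rpower 2 alpha * (alpha + 1) * Rpower 2 (alpha + 4)).
  { repeat apply Rmult_lt_0_compat; trivial; lra. }
  assert (0 < Rpower 2 (alpha + 1) / Bi * (alpha + 1) * Rpower 2 (alpha + 3)).
  { repeat apply Rmult_lt_0_compat; trivial; try lra.
    now apply Rinv_0_lt_compat. }
  assert (0 < 3 * Rpower 2 (alpha + 1) * Rpower 2 (alpha + 2)).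
  { repeat apply Rmult_lt_0_compat; trivial; lra. }
  assert (0 < 3 * (Rpower 2 alpha / Bi) * Rpower 2 (alpha + 1)).
  { repeat apply Rmult_lt_0_compat; trivial; try lra.
    now apply Rinv_0_lt_compat. }
  (* The quadratic term alone beats the constant: [4 * Ste * (alpha + 1) >= 4 * Ste > 3 * Ste]. *)
  nra.
Qed.

Lemma lhs_2h_continuity_pt (alpha Ste Bi z : R) :
  0 < z -> continuity_pt (lhs_2h alpha Ste Bi) z.
Proof.
  intros Hz; apply continuity_pt_filterlim.
  apply (ex_derive_continuous (lhs_2h alpha Ste Bi)).
  unfold lhs_2h, Rpower; auto_derive; repeat split; trivial.
Qed.

Lemma equation_2h_unique_root (alpha Ste Bi : R) :
  0 <= alpha -> 0 < Ste -> 0 < Bi ->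
  exists nu, unique (fun z => 0 < z /\ equation_2h alpha Ste Bi z) nu.
Proof.
  intros Ha HS HB.
  destruct (lhs_2h_neg_near_0 alpha Ste Bi Ha HS HB) as [z0 [Hz0 Hneg]].
  destruct (IVT_interv (lhs_2h alpha Ste Bi) z0 2) as [nu [Hnu Enu]].
  - intros z Hz; apply lhs_2h_continuity_pt; lra.
  - lra.
  - trivial.
  - now apply lhs_2h_pos_at_2.
  - exists nu; split.
    + split; [lra | exact Enu].
    + intros z [Hz Ez].
      change (lhs_2h alpha Ste Bi z = 0) in Ez.
      destruct (Rtotal_order nu z) as [Hlt | [Heq | Hlt]]; trivial; exfalso.
      * assert (H := lhs_2h_increasing alpha Ste Bi nu z Ha HS HB
                       ltac:(lra) Hlt); lra.
      * assert (H := lhs_2h_increasing alpha Ste Bi z nu Ha HS HB Hz Hlt); lra.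
Qed.

(** ** The algebraic system for [A], [B] and [nu] *)

(** Dimensionless forms of (iv), (ii) and (i), in this order, for [s = 2 a nu sqrt t]. In the last
    one, (iv) has already been used to eliminate the power of [nu] with exponent [alpha + 2]. *)
Definition coefficient_system (alpha Ste Bi nu A B : R) : Prop :=
  Ste * A = 2 * (Rpower 2 alpha * Rpower nu alpha) * nu ^ 2 /\
  A + 2 * B = 2 * Bi * nu * (1 - A - B) /\
  (alpha + 1) * nu ^ 2 * (A / 2 + B / 3) = B.

(** The last two equations are linear in [A] and [B], and Cramer's rule gives [A = (6 - 2 m) / E]
    and [B = 3 m / E]; inserting [A] into the first yields the equation for [nu]. The closed forms
    have denominator [Ste * D] instead, because the terms from [E - D] are rewritten by means of the
    first equation. *)
Lemma coefficient_system_iff (alpha Ste Bi nu A B : R) :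
  0 <= alpha -> 0 < Ste -> 0 < Bi -> 0 < nu ->
  coefficient_system alpha Ste Bi nu A B <->
  equation_2h alpha Ste Bi nu /\
  A = A_2h alpha Ste Bi nu /\ B = B_2h alpha Ste Bi nu.
Proof.
  intros Ha HS HB Hnu.
  unfold coefficient_system, equation_2h, A_2h, B_2h.
  rewrite !(Rpower_plus_pow nu alpha 4 4), !(Rpower_plus_pow nu alpha 3 3),
    !(Rpower_plus_pow nu alpha 2 2), !(Rpower_plus_pow nu alpha 1 1),
    !(Rpower_plus_pow 2 alpha 1 1) by (trivial; simpl; lra).
  generalize (Rpower 2 alpha) (Rpower nu alpha); intros p q.
  set (m := (alpha + 1) * nu ^ 2).
  set (D := nu ^ 2 * (alpha + 1) + 2 / Bi * nu * (alpha + 1) + 3).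
  assert (HD : 0 < D).
  { assert (0 < nu ^ 2 * (alpha + 1)) by (apply Rmult_lt_0_compat; nra).
    assert (0 < 2 / Bi * nu * (alpha + 1)).
    { repeat apply Rmult_lt_0_compat; try lra. now apply Rinv_0_lt_compat. }
    unfold D; lra. }
  (* Up to the factor [- 3 / (Bi * nu)], this is the determinant of the linear system. The residuals
     [d1], [d2], [d3] turn each elimination into an identity valid for arbitrary [A] and [B], which
     [field] can check. *)
  set (E := D + 3 / (Bi * nu) + 3).
  set (d1 := Ste * A - 2 * (p * q) * nu ^ 2).
  set (d2 := A + 2 * B - 2 * Bi * nu * (1 - A - B)).
  set (d3 := m * (A / 2 + B / 3) - B).
  set (F := p * (alpha + 1) * (q * nu ^ 4)
    + p * 2 ^ 1 / Bi * (alpha + 1) * (q * nu ^ 3)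
    + 3 * (p * 2 ^ 1) * (q * nu ^ 2) + 3 * (p / Bi) * (q * nu ^ 1)
    + Ste * (alpha + 1) * nu ^ 2 - 3 * Ste).
  split.
  - intros [H1 [H2 H3]].
    assert (Hd1 : d1 = 0) by (unfold d1; lra).
    assert (Hd2 : d2 = 0) by (unfold d2; lra).
    assert (Hd3 : d3 = 0) by (unfold d3; lra).
    assert (EA : A * E - (6 - 2 * m)
      = ((3 - m) * d2 + 6 * (1 + Bi * nu) * d3) / (Bi * nu)).
    { unfold E, D, d2, d3, m; field; lra. }
    assert (EB : B * E - 3 * m
      = 3 * m * d2 / (2 * Bi * nu) - 6 * d3 * (1 / (2 * Bi * nu) + 1)).
    { unfold E, D, d2, d3, m; field; lra. }
    rewrite Hd2, Hd3 in EA, EB.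
    split; [|split].
    + assert (EF : F = Ste / 2 * (A * E - (6 - 2 * m)) - d1 * E / 2).
      { unfold F, E, D, d1, m; field; lra. }
      rewrite EF, EA, Hd1; field; lra.
    + apply eq_div_of_diff; [apply Rgt_not_eq, Rmult_lt_0_compat; trivial |].
      transitivity (Ste * (A * E - (6 - 2 * m)) - 3 * d1 * (1 / (Bi * nu) + 1)).
      { unfold E, D, d1, m; field; lra. }
      rewrite EA, Hd1; field; lra.
    + apply eq_div_of_diff; [apply Rgt_not_eq, Rmult_lt_0_compat; trivial |].
      transitivity (Ste * ((B * E - 3 * m) - 3 * d2 / (2 * Bi * nu))
                    + 3 / 2 * d1 * (1 / (Bi * nu) + 2)).
      { unfold E, D, d1, d2, m; field; lra. }
      rewrite EB, Hd1, Hd2; field; lra.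
  - intros [HF [HA HBB]].
    (* This is [Bi * D], the form in which the denominator appears once [field] has cleared the
       inner fraction. *)
    assert (HD' : nu ^ 2 * (alpha + 1) * Bi + 2 * nu * (alpha + 1) + 3 * Bi <> 0).
    { apply Rgt_not_eq.
      replace (_ + _ + _) with (Bi * D) by (unfold D; field; lra).
      apply Rmult_lt_0_compat; trivial. }
    (* The closed forms satisfy the second equation identically, and the other two residuals are
       multiples of [F]. *)
    assert (Z1 : d1 = - 2 * F / D).
    { unfold d1, F; rewrite HA; unfold D; field; repeat split; lra. }
    assert (Z2 : d2 = 0).
    { unfold d2; rewrite HA, HBB; unfold D; field; repeat split; lra. }
    assert (Z3 : d3 = - F / (Ste * D)).
    { unfold d3, F, m; rewrite HA, HBB; unfold D; field; repeat split; lra. }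
    rewrite HF in Z1, Z3.
    assert (Z1' : d1 = 0) by (rewrite Z1; field; lra).
    assert (Z3' : d3 = 0) by (rewrite Z3; field; split; lra).
    unfold d1, d2, d3, m in *; repeat split; lra.
Qed.

(** ** Calculus of quadratic profiles *)

Lemma is_derive_profile (theta alpha A B : R) (s : R -> R) (x t : R) :
  0 < s t ->
  is_derive (fun y => quadratic_profile theta alpha A B s y t) x
    (- (Rpower t (alpha / 2) * theta * (A + 2 * B * (1 - x / s t)) / s t)).
Proof.
  intros Hs; unfold quadratic_profile; auto_derive; trivial; field; lra.
Qed.

(** The two-sided derivative of the polynomial restricts to the domain, where [T] agrees with it.
    Uniqueness holds because every point of [[0, s t]], endpoints included, is a limit point of that
    interval. *)
Lemma is_derive_space_iff (theta alpha A B : R) (T : R -> R -> R)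
    (s : R -> R) (x t l : R) :
  0 < s t -> 0 <= x <= s t ->
  (forall y, 0 <= y <= s t -> T y t = quadratic_profile theta alpha A B s y t) ->
  is_derive_space T s x t l <->
  l = - (Rpower t (alpha / 2) * theta * (A + 2 * B * (1 - x / s t)) / s t).
Proof.
  intros Hs Hx HT.
  set (l0 := - (_ / s t)).
  assert (H0 : is_derive_space T s x t l0).
  { assert (Hd : D_in (fun y => quadratic_profile theta alpha A B s y t)
                   (fun _ => l0) (fun y => 0 <= y <= s t) x).
    { assert (H := is_derive_profile theta alpha A B s x t Hs).
      apply is_derive_Reals in H.
      intros eps Heps; destruct (H eps Heps) as [del Hdel].
      exists del; split; [apply cond_pos|].
      intros y [[Hy Hxy] Hdist].
      specialize (Hdel (y - x) ltac:(lra) Hdist).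
      rewrite Rplus_minus in Hdel.
      exact Hdel. }
    intros eps Heps; destruct (Hd eps Heps) as [del [Hdel H]].
    exists del; split; trivial.
    intros y Hy; rewrite (HT x Hx), (HT y (proj1 (proj1 Hy))); now apply H. }
  split; [intros H | now intros ->].
  refine (single_limit _ _ _ _ _ _ H H0).
  intros e He.
  (* A nearby point of the domain is taken to the left of the right endpoint, and to the right of
     any other [x]; the minimum keeps it inside. *)
  destruct (Rle_lt_dec (s t) x) as [Hxs | Hxs].
  - exists (x - Rmin (s t) (e / 2)).
    assert (0 < Rmin (s t) (e / 2)) by (apply Rmin_glb_lt; lra).
    assert (R1 := Rmin_l (s t) (e / 2)); assert (R2 := Rmin_r (s t) (e / 2)).
    split; [split; lra|].
    unfold Rdist; rewrite Rabs_left; lra.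
  - exists (x + Rmin (s t - x) (e / 2)).
    assert (0 < Rmin (s t - x) (e / 2)) by (apply Rmin_glb_lt; lra).
    assert (R1 := Rmin_l (s t - x) (e / 2)).
    assert (R2 := Rmin_r (s t - x) (e / 2)).
    split; [split; lra|].
    unfold Rdist; rewrite Rabs_right; lra.
Qed.

Lemma RInt_profile (theta alpha A B : R) (T : R -> R -> R) (s : R -> R) (t : R) :
  0 < s t ->
  (forall y, 0 <= y <= s t -> T y t = quadratic_profile theta alpha A B s y t) ->
  RInt (fun x => T x t) 0 (s t)
  = Rpower t (alpha / 2) * theta * (A / 2 + B / 3) * s t.
Proof.
  intros Hs HT.
  rewrite (RInt_ext _ (fun y => quadratic_profile theta alpha A B s y t)).
  2: { intros y; rewrite Rmin_left, Rmax_right by lra.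
       intros Hy; apply HT; lra. }
  (* An antiderivative of the profile that vanishes at [s t]. *)
  set (G := fun y => - (Rpower t (alpha / 2) * theta * s t
    * (A / 2 * (1 - y / s t) ^ 2 + B / 3 * (1 - y / s t) ^ 3))).
  apply is_RInt_unique.
  replace (Rpower t (alpha / 2) * theta * (A / 2 + B / 3) * s t)
    with (minus (G (s t)) (G 0)).
  2: { unfold minus, plus, opp; simpl; unfold G; field; lra. }
  apply (is_RInt_derive G).
  - intros y _; unfold G, quadratic_profile; auto_derive; trivial; field; lra.
  - intros y _.
    apply (ex_derive_continuous
             (fun y : R => quadratic_profile theta alpha A B s y t)).
    eexists; now apply is_derive_profile.
Qed.

Lemma is_derive_energy_iff (theta alpha A B : R) (T : R -> R -> R)
    (s : R -> R) (t v : R) :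
  0 < t -> (forall r, 0 < r -> 0 < s r) -> ex_derive s t ->
  (forall y r, 0 < r -> 0 <= y <= s r ->
     T y r = quadratic_profile theta alpha A B s y r) ->
  is_derive (fun r => RInt (fun x => T x r) 0 (s r)) t v <->
  v = Rpower t (alpha / 2) * theta * (A / 2 + B / 3)
      * (alpha / (2 * t) * s t + Derive s t).
Proof.
  intros Ht Hs Hds HT.
  set (v0 := _ * (_ + _)).
  assert (H0 : is_derive (fun r => RInt (fun x => T x r) 0 (s r)) t v0).
  { apply (is_derive_ext_loc
      (fun r => Rpower r (alpha / 2) * theta * (A / 2 + B / 3) * s r)).
    - apply (locally_interval _ t 0 p_infty); simpl; trivial.
      intros r Hr _; symmetry.
      apply (RInt_profile theta alpha); auto.
    - unfold v0, Rpower; auto_derive; [repeat split; trivial |].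
      change (fun x : R => s x) with s; field; lra. }
  split; [intros H | now intros ->].
  now rewrite <- (is_derive_unique _ _ _ H), <- (is_derive_unique _ _ _ H0).
Qed.

(** ** The problem at a fixed time *)

(** The derivatives are determined by the profile, so the existential quantifiers disappear, and
    (iii) holds automatically since the profile vanishes at [x = s t]. What remains is (i), (ii) and
    (iv). *)
Lemma problem_at_iff (k gamma theta h alpha a A B : R) (T : R -> R -> R)
    (s : R -> R) (t : R) :
  0 < t -> (forall r, 0 < r -> 0 < s r) -> ex_derive s t ->
  (forall y r, 0 < r -> 0 <= y <= s r ->
     T y r = quadratic_profile theta alpha A B s y r) ->
  (exists Tx_0 Tx_s : R,
      is_derive_space T s 0 t Tx_0 /\
      is_derive_space T s (s t) t Tx_s /\
      is_derive (fun r => RInt (fun x => T x r) 0 (s r)) t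
        (- a ^ 2 * (gamma / k * Rpower (s t) alpha * Derive s t + Tx_0)) /\
      k * Tx_0 = h / sqrt t * (T 0 t - theta * Rpower t (alpha / 2)) /\
      T (s t) t = 0 /\
      k * Tx_s = - gamma * Rpower (s t) alpha * Derive s t) <->
  - a ^ 2 * (gamma / k * Rpower (s t) alpha * Derive s t
             - Rpower t (alpha / 2) * theta * (A + 2 * B) / s t)
  = Rpower t (alpha / 2) * theta * (A / 2 + B / 3)
    * (alpha / (2 * t) * s t + Derive s t) /\
  - k * (Rpower t (alpha / 2) * theta * (A + 2 * B) / s t)
  = h / sqrt t * (Rpower t (alpha / 2) * theta * (A + B - 1)) /\
  k * (Rpower t (alpha / 2) * theta * A / s t)
  = gamma * Rpower (s t) alpha * Derive s t.
Proof.
  intros Ht Hs Hds HT.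
  assert (Hst := Hs t Ht).
  assert (HTt := fun y => HT y t Ht).
  assert (D0 := fun l => is_derive_space_iff theta alpha A B T s 0 t l Hst
                           ltac:(lra) HTt).
  assert (Ds := fun l => is_derive_space_iff theta alpha A B T s (s t) t l Hst
                           ltac:(lra) HTt).
  assert (DE := fun v => is_derive_energy_iff theta alpha A B T s t v
                           Ht Hs Hds HT).
  assert (T0 : T 0 t = Rpower t (alpha / 2) * theta * (A + B)).
  { rewrite HTt by lra; unfold quadratic_profile; field; lra. }
  assert (Ts : T (s t) t = 0).
  { rewrite HTt by lra; unfold quadratic_profile; field; lra. }
  replace (1 - 0 / s t) with 1 in D0 by (field; lra).
  replace (1 - s t / s t) with 0 in Ds by (field; lra).
  set (u := Rpower t (alpha / 2)) in *.
  split.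
  - intros [l0 [ls [H0 [Hls [HE [HR [_ HS]]]]]]].
    apply D0 in H0; apply Ds in Hls; apply DE in HE.
    rewrite T0 in HR; subst l0 ls.
    repeat split; unfold Rdiv in *; lra.
  - intros [HE [HR HS]].
    exists (- (u * theta * (A + 2 * B * 1) / s t)),
      (- (u * theta * (A + 2 * B * 0) / s t)).
    split; [now apply D0 |]. split; [now apply Ds |].
    split; [apply DE; unfold Rdiv in *; lra |].
    rewrite T0; repeat split; trivial; unfold Rdiv in *; lra.
Qed.

Lemma Rpower_s_2h (alpha a nu t : R) :
  0 < a -> 0 < nu -> 0 < t ->
  Rpower (2 * a * nu * sqrt t) alpha
  = Rpower 2 alpha * Rpower a alpha * Rpower nu alpha * Rpower t (alpha / 2).
Proof.
  intros Ha Hnu Ht.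
  rewrite <- Rpower_sqrt by trivial.
  rewrite !Rpower_mult_distr, ?Rpower_mult by
    (try apply exp_pos; repeat apply Rmult_lt_0_compat; lra).
  replace (alpha / 2) with (/ 2 * alpha) by field.
  rewrite <- Rpower_mult, Rpower_mult_distr; trivial;
    [repeat apply Rmult_lt_0_compat; lra | apply exp_pos].
Qed.

Lemma similarity_system_iff (k gamma theta h alpha a nu A B t : R) :
  0 < k -> 0 < gamma -> 0 < theta -> 0 < a -> 0 < nu -> 0 < t ->
  let st := 2 * a * nu * sqrt t in
  let ds := a * nu / sqrt t in
  (- a ^ 2 * (gamma / k * Rpower st alpha * ds
             - Rpower t (alpha / 2) * theta * (A + 2 * B) / st)
   = Rpower t (alpha / 2) * theta * (A / 2 + B / 3)
     * (alpha / (2 * t) * st + ds) /\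
   - k * (Rpower t (alpha / 2) * theta * (A + 2 * B) / st)
   = h / sqrt t * (Rpower t (alpha / 2) * theta * (A + B - 1)) /\
   k * (Rpower t (alpha / 2) * theta * A / st)
   = gamma * Rpower st alpha * ds) <->
  coefficient_system alpha (Stefan_number k gamma theta alpha a)
    (Biot_number k h a) nu A B.
Proof.
  intros Hk Hg Hth Ha Hnu Ht st ds.
  unfold coefficient_system, Stefan_number, Biot_number.
  rewrite (Rpower_plus_pow a alpha 2 2) by (trivial; simpl; lra).
  unfold st, ds; rewrite Rpower_s_2h by trivial.
  assert (Hw : 0 < sqrt t) by now apply sqrt_lt_R0.
  assert (Hwt : t = sqrt t ^ 2) by (simpl; rewrite Rmult_1_r, sqrt_sqrt; lra).
  assert (Hu : 0 < Rpower t (alpha / 2)) by apply exp_pos.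
  assert (Hpa : 0 < Rpower a alpha) by apply exp_pos.
  revert Hwt Hw Hu Hpa.
  generalize (Rpower t (alpha / 2)) (Rpower a alpha) (sqrt t)
    (Rpower 2 alpha) (Rpower nu alpha).
  (* With [t = w ^ 2] and all real powers turned into variables, the equations become rational
     identities. *)
  intros u pa w p q Hwt Hw Hu Hpa; subst t.
  set (Ste := k * theta / (gamma * (pa * a ^ 2))).
  assert (E1 : k * (u * theta * A / (2 * a * nu * w))
     = gamma * (p * pa * q * u) * (a * nu / w) <->
     Ste * A = 2 * (p * q) * nu ^ 2).
  { apply (eq_iff_of_scaled_diff (u * gamma * pa * a / (2 * nu * w))).
    - apply Rgt_not_eq, Rdiv_lt_0_compat; repeat apply Rmult_lt_0_compat; lra.
    - unfold Ste; field; repeat split; lra. }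
  assert (E2 : - k * (u * theta * (A + 2 * B) / (2 * a * nu * w))
     = h / w * (u * theta * (A + B - 1)) <->
     A + 2 * B = 2 * (a * h / k) * nu * (1 - A - B)).
  { apply (eq_iff_of_scaled_diff (- (k * u * theta / (2 * a * nu * w)))).
    - apply Rlt_not_eq, Ropp_lt_gt_0_contravar, Rdiv_lt_0_compat;
        repeat apply Rmult_lt_0_compat; lra.
    - field; repeat split; lra. }
  (* The balance (i) contains the flux term of (iv), so its reduced form is equivalent to it only
     modulo the first equation, which is available on both sides. *)
  assert (E3 : Ste * A = 2 * (p * q) * nu ^ 2 ->
     (- a ^ 2 * (gamma / k * (p * pa * q * u) * (a * nu / w)
        - u * theta * (A + 2 * B) / (2 * a * nu * w))
      = u * theta * (A / 2 + B / 3)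
        * (alpha / (2 * w ^ 2) * (2 * a * nu * w) + a * nu / w) <->
      (alpha + 1) * nu ^ 2 * (A / 2 + B / 3) = B)).
  { intros H1.
    apply (eq_iff_of_scaled_diff (- (u * theta * a / (nu * w)))).
    - apply Rlt_not_eq, Ropp_lt_gt_0_contravar, Rdiv_lt_0_compat;
        repeat apply Rmult_lt_0_compat; lra.
    - match goal with |- ?l = ?r =>
        assert (E : l - r = gamma * u * a ^ 3 * pa / (2 * k * nu * w)
                            * (Ste * A - 2 * (p * q) * nu ^ 2))
          by (unfold Ste; field; repeat split; lra)
      end.
      rewrite H1 in E; lra. }
  tauto.
Qed.

(** * Existence: the explicit pair solves the problem *)

Lemma is_derive_s_2h (a nu t : R) :
  0 < t -> is_derive (s_2h a nu) t (a * nu / sqrt t).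
Proof.
  intros Ht; unfold s_2h; auto_derive; trivial.
  field; apply Rgt_not_eq, sqrt_lt_R0, Ht.
Qed.

Lemma s_2h_pos (a nu t : R) : 0 < a -> 0 < nu -> 0 < t -> 0 < s_2h a nu t.
Proof.
  intros Ha Hnu Ht; unfold s_2h.
  repeat apply Rmult_lt_0_compat; try lra; now apply sqrt_lt_R0.
Qed.

Lemma candidate_2h (theta alpha Ste Bi a nu : R) :
  0 < a -> 0 < nu ->
  candidate theta alpha (T_2h theta alpha Ste Bi a nu) (s_2h a nu).
Proof.
  intros Ha Hnu; split.
  (* Two-sided continuity is available even at 0, since [sqrt] is totalised by 0 on negative
     numbers; it is then restricted to the half-line. *)
  - intros t Ht P HP; apply filter_le_within; revert P HP.
    apply (continuous_mult (fun _ : R => 2 * a * nu) sqrt).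
    + apply continuous_const.
    + apply continuity_pt_filterlim, continuity_pt_sqrt, Ht.
  - intros t Ht; unfold s_2h.
    apply Rmult_le_pos; [|apply sqrt_pos].
    repeat apply Rmult_le_pos; lra.
  - intros t; now apply s_2h_pos.
  - intros t Ht; split; [eexists; now apply is_derive_s_2h |].
    apply (continuous_ext_loc _ (fun r => a * nu / sqrt r)).
    + apply (locally_interval _ t 0 p_infty); simpl; trivial.
      intros r Hr _; symmetry; now apply is_derive_unique, is_derive_s_2h.
    + assert (0 < sqrt t) by now apply sqrt_lt_R0.
      apply (ex_derive_continuous (fun r : R => a * nu / sqrt r)).
      auto_derive; repeat split; trivial; lra.
  - exists (A_2h alpha Ste Bi nu), (B_2h alpha Ste Bi nu); trivial.
Qed.

Lemma problem_P2h_solution (k gamma theta h alpha a nu : R) :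
  0 < k -> 0 < gamma -> 0 < theta -> 0 < h -> 0 <= alpha -> 0 < a -> 0 < nu ->
  let Ste := Stefan_number k gamma theta alpha a in
  let Bi := Biot_number k h a in
  0 < Ste -> 0 < Bi -> equation_2h alpha Ste Bi nu ->
  problem_P2h k gamma theta h alpha a
    (T_2h theta alpha Ste Bi a nu) (s_2h a nu).
Proof.
  intros Hk Hg Hth Hh Hal Ha Hnu Ste Bi HS HB Heq.
  split; [now apply candidate_2h |].
  split; [|unfold s_2h; rewrite sqrt_0; ring].
  intros t Ht.
  apply (problem_at_iff _ _ _ _ _ _ (A_2h alpha Ste Bi nu) (B_2h alpha Ste Bi nu));
    trivial.
  - intros r Hr; now apply s_2h_pos.
  - eexists; now apply is_derive_s_2h.
  - rewrite (is_derive_unique _ _ _ (is_derive_s_2h a nu t Ht)).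
    apply similarity_system_iff; trivial.
    apply coefficient_system_iff; auto.
Qed.

(** * Uniqueness: every solution is the explicit one *)

Lemma robin_nondegenerate (k gamma theta h alpha a A B t st ds : R) :
  0 < k -> 0 < gamma -> 0 < theta -> 0 <= alpha -> 0 < t -> 0 < st ->
  - a ^ 2 * (gamma / k * Rpower st alpha * ds
             - Rpower t (alpha / 2) * theta * (A + 2 * B) / st)
  = Rpower t (alpha / 2) * theta * (A / 2 + B / 3) * (alpha / (2 * t) * st + ds) ->
  - k * (Rpower t (alpha / 2) * theta * (A + 2 * B) / st)
  = h / sqrt t * (Rpower t (alpha / 2) * theta * (A + B - 1)) ->
  k * (Rpower t (alpha / 2) * theta * A / st)
  = gamma * Rpower st alpha * ds ->
  A + B <> 1.
Proof.
  intros Hk Hg Hth Hal Ht Hst HE HR HS HAB.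
  assert (Hu : 0 < Rpower t (alpha / 2)) by apply exp_pos.
  assert (HP : 0 < Rpower st alpha) by apply exp_pos.
  set (u := Rpower t (alpha / 2)) in *; set (P := Rpower st alpha) in *.
  assert (Hc : 0 < k * (u * theta) / st)
    by (apply Rdiv_lt_0_compat; repeat apply Rmult_lt_0_compat; trivial).
  assert (H2 : A + 2 * B = 0).
  { apply (Rmult_eq_reg_l (k * (u * theta) / st)); [|lra].
    replace (A + B - 1) with 0 in HR by lra.
    unfold Rdiv in *; lra. }
  assert (A = 2) by lra; assert (B = -1) by lra; subst A B.
  assert (Hds : 0 < ds).
  { apply (Rmult_lt_reg_l (gamma * P)); [now apply Rmult_lt_0_compat |].
    unfold Rdiv in *; lra. }
  replace (2 + 2 * -1) with 0 in HE by ring.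
  assert (0 <= alpha / (2 * t) * st).
  { apply Rmult_le_pos; [apply Rdiv_le_0_compat |]; lra. }
  (* The mean value factor is [2/3], so the right-hand side of (i) is positive, while its left-hand
     side is at most 0. *)
  assert (0 < u * theta * (2 / 2 + -1 / 3) * (alpha / (2 * t) * st + ds)).
  { repeat apply Rmult_lt_0_compat; lra. }
  assert (0 <= a ^ 2 * (gamma / k * P * ds)).
  { apply Rmult_le_pos; [apply pow2_ge_0 |].
    repeat apply Rmult_le_pos; try lra. left; now apply Rinv_0_lt_compat. }
  unfold Rdiv in *; lra.
Qed.

Lemma problem_P2h_similarity (k gamma theta h alpha a A B : R)
    (T : R -> R -> R) (s : R -> R) :
  0 < k -> 0 < gamma -> 0 < theta -> 0 < h -> 0 <= alpha -> 0 < a ->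
  problem_P2h k gamma theta h alpha a T s ->
  (forall x t, 0 < t -> 0 <= x <= s t ->
     T x t = quadratic_profile theta alpha A B s x t) ->
  exists nu, 0 < nu /\ (forall t, 0 <= t -> s t = s_2h a nu t) /\
    coefficient_system alpha (Stefan_number k gamma theta alpha a)
      (Biot_number k h a) nu A B.
Proof.
  intros Hk Hg Hth Hh Hal Ha [Hcand [Hat Hs0]] HT.
  assert (Hpos := candidate_pos _ _ _ _ Hcand).
  assert (Hd : forall t, 0 < t -> ex_derive s t)
    by (intros t Ht; apply (candidate_C1 _ _ _ _ Hcand t Ht)).
  assert (Hsys := fun t Ht =>
    proj1 (problem_at_iff k gamma theta h alpha a A B T s t Ht Hpos (Hd t Ht) HT)
      (Hat t Ht)).
  assert (Hne : A + B <> 1).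
  { destruct (Hsys 1 Rlt_0_1) as [HE [HR HS]].
    exact (robin_nondegenerate _ _ _ _ _ _ _ _ _ _ _ Hk Hg Hth Hal Rlt_0_1
             (Hpos 1 Rlt_0_1) HE HR HS). }
  (* The value of [s t / (2 * a * sqrt t)] obtained by solving (ii); it does not depend on [t]. *)
  set (nu := k * (A + 2 * B) / (2 * a * h * (1 - A - B))).
  assert (Hs : forall t, 0 < t -> s t = s_2h a nu t).
  { intros t Ht; destruct (Hsys t Ht) as [_ [HR _]].
    assert (Hst := Hpos t Ht).
    assert (Hw : 0 < sqrt t) by now apply sqrt_lt_R0.
    assert (Hu : 0 < Rpower t (alpha / 2)) by apply exp_pos.
    apply (eq_iff_of_scaled_diff
      (Rpower t (alpha / 2) * theta * h * (1 - A - B) / (s t * sqrt t))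
      _ _ (s t) (s_2h a nu t)) in HR; trivial.
    - apply Rmult_integral_contrapositive_currified;
        [repeat apply Rmult_integral_contrapositive_currified; lra |].
      apply Rinv_neq_0_compat, Rmult_integral_contrapositive_currified; lra.
    - unfold s_2h, nu; field; repeat split; lra. }
  assert (Hnu : 0 < nu).
  { assert (H := Hpos 1 Rlt_0_1); rewrite (Hs 1 Rlt_0_1) in H.
    unfold s_2h in H; rewrite sqrt_1 in H.
    apply (Rmult_lt_reg_l (2 * a)); lra. }
  exists nu; split; trivial; split.
  - intros t [Ht | <-]; auto.
    rewrite Hs0; unfold s_2h; rewrite sqrt_0; ring.
  - assert (Hds : Derive s 1 = a * nu / sqrt 1).
    { rewrite <- (is_derive_unique _ _ _ (is_derive_s_2h a nu 1 Rlt_0_1)).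
      apply Derive_ext_loc.
      apply (locally_interval _ 1 0 p_infty); simpl; trivial; [lra|].
      intros r Hr _; now apply Hs. }
    (* One time suffices, because the reduced system no longer contains [t]. *)
    assert (H := Hsys 1 Rlt_0_1).
    rewrite Hds, (Hs 1 Rlt_0_1) in H.
    exact (proj1 (similarity_system_iff k gamma theta h alpha a nu A B 1
                    Hk Hg Hth Ha Hnu Rlt_0_1) H).
Qed.

Theorem theorem4p2 (k rho c gamma theta h alpha : R)
    (hk : 0 < k) (hrho : 0 < rho) (hc : 0 < c) (hgamma : 0 < gamma)
    (htheta : 0 < theta) (hh : 0 < h) (halpha : 0 <= alpha) :
  let a := diffusion_coef k rho c in
  let Ste := Stefan_number k gamma theta alpha a in
  let Bi := Biot_number k h a in
  exists nu : R,
    unique (fun z => 0 < z /\ equation_2h alpha Ste Bi z) nu /\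
    problem_P2h k gamma theta h alpha a
      (T_2h theta alpha Ste Bi a nu) (s_2h a nu) /\
    (forall (T : R -> R -> R) (s : R -> R),
      problem_P2h k gamma theta h alpha a T s ->
      (forall t, 0 <= t -> s t = s_2h a nu t) /\
      (forall x t, 0 < t -> 0 <= x <= s_2h a nu t ->
        T x t = T_2h theta alpha Ste Bi a nu x t)).
Proof.
  intros a Ste Bi.
  assert (Ha : 0 < a).
  { apply sqrt_lt_R0, Rdiv_lt_0_compat; trivial; now apply Rmult_lt_0_compat. }
  assert (HS : 0 < Ste).
  { apply Rdiv_lt_0_compat; apply Rmult_lt_0_compat; trivial; apply exp_pos. }
  assert (HB : 0 < Bi).
  { apply Rdiv_lt_0_compat; trivial; now apply Rmult_lt_0_compat. }
  destruct (equation_2h_unique_root alpha Ste Bi halpha HS HB)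
    as [nu [[Hnu Heq] Huniq]].
  exists nu; split; [now split |]; split.
  - now apply problem_P2h_solution.
  - intros T s HP.
    destruct (candidate_profile _ _ _ _ (proj1 HP)) as [A [B HT]].
    destruct (problem_P2h_similarity k gamma theta h alpha a A B T s)
      as [nu' [Hnu' [Hs Hsys]]]; trivial.
    apply coefficient_system_iff in Hsys; trivial.
    destruct Hsys as [Heq' [HA HBB]].
    (* The coefficient of an arbitrary solution is a positive root, hence equals [nu]; this fixes
       [s], [A] and [B] together. *)
    assert (Enu := Huniq nu' (conj Hnu' Heq')); subst nu'.
    split; trivial.
    intros x t Ht Hx.
    rewrite HT by (rewrite ?Hs by lra; lra).
    rewrite HA, HBB; unfold T_2h, quadratic_profile; rewrite Hs by lra; trivial.
Qed.
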